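(* Let $(M_n,d_n)$, $n\in\mathbb N$, be a sequence of separable complete metric spaces. Then (i) $E((M_n)_{n\in\mathbb N},0)\le_B\mathbb R^{\mathbb N}/c_0$; (ii) $E((M_n)_{n\in\mathbb N},0)\le_B E([0,1],0)$; (iii) $E((M_n)_{n\in\mathbb N},0)\le_B E((I_n)_{n\in\mathbb N},0)$, where $I_n=\{\frac{k}{2^n}:k\in\mathbb N,\ 0\le k\le 2^n\}$.
   Context: For separable complete metric spaces $(M_n,d_n)$, $E((M_n)_{n\in\mathbb N},0)$ is the equivalence relation on $\prod_n M_n$ given by $(x,y)\in E((M_n),0)\iff\lim_n d_n(x(n),y(n))=0$; when all $M_n=M$ it is written $E(M,0)$. Here $[0,1]$ and $I_n$ carry the usual metric $|s-t|$. $\mathbb R^{\mathbb N}/c_0$ is the relation on $\mathbb R^{\mathbb N}$ with $x\sim y\iff x(n)-y(n)\to0$. $E\le_B F$ means there is a Borel map $\theta$ between the underlying Polish spaces with $(x,y)\in E\iff(\theta(x),\theta(y))\in F$. *)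

(* Defs.v *)
From HB Require Import structures.
From mathcomp Require Import all_boot all_order all_algebra.
From mathcomp Require Import all_classical all_reals all_analysis.

Set Implicit Arguments.
Unset Strict Implicit.
Unset Printing Implicit Defensive.

Import Order.TTheory GRing.Theory Num.Theory.
Import numFieldNormedType.Exports.

Local Open Scope classical_set_scope.
Local Open Scope ring_scope.

(* The library equips [set_type A] with the pseudometric induced from the
   ambient space; when the latter is metric, so is the subspace, with the
   restricted distance. *)
Section set_type_metric.
Context {R : realType} {X : metricType R} (A : set X).

Let dist (x y : A) : R := mdist (set_val x) (set_val y).

Let dist_ge0 (x y : A) : 0 <= dist x y.
Proof. exact: mdist_ge0. Qed.

Let dist_positivity (x y : A) : dist x y = 0 -> x = y.
Proof. by move=> /mdist_positivity; exact: val_inj. Qed.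

Let ballEdist (x : A) (d : R) : ball x d = [set y | dist x y < d].
Proof.
have -> : ball x d = [set y : A | ball (set_val x) d (set_val y)] by [].
by rewrite ballEmdist.
Qed.

HB.instance Definition _ := @PseudoMetric_isMetric.Build R (set_type A)
  dist dist_ge0 dist_positivity ballEdist.

End set_type_metric.

Definition separable_space (T : topologicalType) : Prop :=
  exists2 D : set T, countable D & dense D.

(* [completeType] is not used because it requires a point, which would exclude
   the empty metric space. *)
Definition complete_space (R : realType) (M : metricType R) : Prop :=
  forall u : nat -> M, cauchy (u n @[n --> \oo]) ->
    exists l : M, u n @[n --> \oo] --> l.

Definition borel_set (T : topologicalType) : set (set T) := <<s @open T >>.

Definition borel_map (T U : topologicalType) (f : T -> U) : Prop :=
  forall B : set U, borel_set B -> borel_set (f @^-1` B).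

Definition borel_reducible (T U : topologicalType)
    (E : T -> T -> Prop) (F : U -> U -> Prop) : Prop :=
  exists2 theta : T -> U, borel_map theta &
    forall x y : T, E x y <-> F (theta x) (theta y).

Definition Eprod0 (R : realType) (M : nat -> metricType R)
    (x y : prod_topology M) : Prop :=
  mdist (x n) (y n) @[n --> \oo] --> (0 : R).

Definition Rmodc0 (R : realType) (x y : {ptws nat -> (R : topologicalType)}) :
    Prop :=
  x n - y n @[n --> \oo] --> (0 : R).

(* [R^o] is the copy of [R] that carries the library's metric [`|y - x|]. *)
Definition unit_interval (R : realType) : set R^o := `[0, 1].

Definition dyadic_grid (R : realType) (n : nat) : set R^o :=
  [set (k%:R / 2 ^+ n : R) | k in [set k : nat | (k <= 2 ^ n)%N]].

(* Main.v *)
Require Import Defs.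
From HB Require Import structures.
From mathcomp Require Import all_boot all_order all_algebra.
From mathcomp Require Import all_classical all_reals all_analysis.
From mathcomp Require Import ring lra.

(* Every separable metric space maps into [c_0] by Aharoni's bumps: at each scale
   [r = 2 ^- j] there are countably many 1-Lipschitz functions with values in
   [0, r], only finitely many of them nonzero at a given point, which separate
   points at distance at least [5 r].  Applying them to every entry of a sequence
   and listing the values along a single index gives a continuous map to
   [0, 1]^nat that reduces [Eprod0] to convergence of the differences to [0].
   Rounding the [n]-th value down to a multiple of [2 ^- n] changes it by a null
   sequence, and is Borel since each rounded coordinate has countable range. *)

Set Implicit Arguments.
Unset Strict Implicit.
Unset Printing Implicit Defensive.

Import Order.TTheory GRing.Theory Num.Theory.
Import numFieldNormedType.Exports.

Local Open Scope classical_set_scope.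
Local Open Scope ring_scope.

(** * Borel sets and Borel maps *)

Section borel.
Context {T : topologicalType}.
Implicit Types A B : set T.

Lemma borel_set_sigma_algebra : sigma_algebra setT (@borel_set T).
Proof. exact: smallest_sigma_algebra. Qed.

Lemma borel_open A : open A -> borel_set A.
Proof. exact: sub_gen_smallest. Qed.

Lemma borel_setC A : borel_set A -> borel_set (~` A).
Proof.
by have [_ + _] := borel_set_sigma_algebra => /[apply]; rewrite setTD.
Qed.

Lemma borel_bigcup (F : nat -> set T) :
  (forall i, borel_set (F i)) -> borel_set (\bigcup_i F i).
Proof. by have [_ _] := borel_set_sigma_algebra; apply. Qed.

Lemma borel_set0 : borel_set (set0 : set T).
Proof. by have [] := borel_set_sigma_algebra. Qed.

Lemma borel_bigcap (F : nat -> set T) :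
  (forall i, borel_set (F i)) -> borel_set (\bigcap_i F i).
Proof.
move=> bF; rewrite -[\bigcap_i _]setCK setC_bigcap.
by apply: borel_setC; apply: borel_bigcup => i; exact: borel_setC.
Qed.

Lemma borel_setI A B : borel_set A -> borel_set B -> borel_set (A `&` B).
Proof.
move=> bA bB; rewrite -bigcap2E; apply: borel_bigcap => -[|[|i]]//=.
by apply: borel_open; exact: openT.
Qed.

(** The sets with Borel preimage form a sigma-algebra, so a test on the generators suffices. *)
Lemma borel_map_open (U : topologicalType) (f : T -> U) :
  (forall A : set U, open A -> borel_set (f @^-1` A)) -> borel_map f.
Proof.
move=> oP B bB.
have fB : image_set_system setT f (@borel_set T) B.
  apply: (smallest_sub _ _ bB).
    exact: sigma_algebra_image borel_set_sigma_algebra.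
  by move=> A oA; rewrite /image_set_system/= setTI; exact: oP.
by move: fB; rewrite /image_set_system/= setTI.
Qed.

Lemma continuous_borel_map (U : topologicalType) (f : T -> U) :
  continuous f -> borel_map f.
Proof.
by move=> /continuousP cf; apply: borel_map_open => A oA; apply: borel_open; exact: cf.
Qed.

End borel.

(** * Maps into product spaces *)

Lemma cvg_prod_topology (I : Type) (U : I -> topologicalType) (S : Type)
    (F : set_system S) (h : S -> prod_topology U) (z : prod_topology U) :
  Filter F -> (forall i, h s i @[s --> F] --> z i) -> h @ F --> z.
Proof.
move=> FF hz; apply/cvg_sup => i A.
rewrite (@nbhsE (initial_topology (fun f : prod_topology U => f i))).
move=> [_ [[V oV <-] Vz] VA]; apply: (filterS VA).
by apply: hz; exact: open_nbhs_nbhs.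
Qed.

Lemma continuous_prod_topology (I : Type) (U : I -> topologicalType)
    (T : topologicalType) (f : T -> prod_topology U) :
  (forall i, continuous (fun x => f x i)) -> continuous f.
Proof. by move=> cf x; apply: cvg_prod_topology => i; exact: cf. Qed.

(* An open set is a union of cylinders over finite code sequences, and there are
   only countably many of those. *)
Lemma borel_map_countable_coordinates (T : topologicalType)
    (U : nat -> topologicalType) (c : forall n, U n -> nat)
    (f : T -> prod_topology U) :
  (forall n, injective (@c n)) ->
  (forall n k, borel_set [set x | c n (f x n) = k]) -> borel_map f.
Proof.
move=> cI bc; apply: borel_map_open => O oO.
pose C (s : seq nat) : set (prod_topology U) :=
  [set z | forall i, (i < size s)%N -> c i (z i) = nth 0%N s i].
have bC s : borel_set (f @^-1` C s).
  have -> : f @^-1` C s = \bigcap_i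
      (if (i < size s)%N then [set x | c i (f x i) = nth 0%N s i] else setT).
    apply/seteqP; split=> [x Cx i _|x Cx i si].
      by case: ifPn => // si; exact: Cx.
    by have := Cx i I; rewrite si.
  apply: borel_bigcap => i; case: ifP => _; first exact: bc.
  by apply: borel_open; exact: openT.
have -> : f @^-1` O = \bigcup_m
    (if @pickle_inv (seq nat) m is Some s then
       if `[< C s `<=` O >] then f @^-1` C s else set0 else set0).
  apply/seteqP; split=> [x Ox|x [m _]]; last first.
    by case: (pickle_inv m) => // s; case: ifPn => // /asboolP sO Cx; exact: sO.
  suff [N CO] : exists N, C (mkseq (fun i => c i (f x i)) N) `<=` O.
    exists (pickle (mkseq (fun i => c i (f x i)) N)) => //.
    rewrite pickleK_inv; case: ifPn => [_ i|/asboolPn//].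
    by rewrite size_mkseq => iN; rewrite nth_mkseq.
  (* Otherwise some [w N] outside [O] has the same first [N] codes as [f x]. As codes determine
     coordinates, each coordinate of [w] is eventually that of [f x], so [w] tends to [f x], against
     openness of [O]. *)
  apply: contrapT => /forallNP nCO.
  have /choice[w wP] N : exists w : prod_topology U,
      C (mkseq (fun i => c i (f x i)) N) w /\ ~ O w.
    by apply: contrapT => nw; apply: (nCO N) => z Cz; apply: contrapT => nOz;
       apply: nw; exists z.
  have wx : w @ \oo --> f x.
    apply: cvg_prod_topology => i; apply: cvg_near_cst.
    exists i.+1 => // N /= iN; apply: cI.
    by have [+ _] := wP N => /(_ i); rewrite size_mkseq nth_mkseq//; apply.
  have : nbhs (f x) O by exact: open_nbhs_nbhs.
  by move=> /wx [N _ /(_ N (leqnn _))]; have [_] := wP N.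
apply: borel_bigcup => m; case: (pickle_inv m) => [s|]; last exact: borel_set0.
by case: ifP => _; [exact: bC|exact: borel_set0].
Qed.

(** * Bump functions at one scale *)

Section bumps.
Context {R : realType} {X : metricType R}.
Implicit Types (x y z : X) (A : set X).

(* [bump r A x] is [max 0 (r - d(x, A))]; in particular it is [0] if [A] is
   empty, the supremum of the empty set being [0]. *)
Definition bump (r : R) A x : R := sup [set Num.max 0 (r - mdist x a) | a in A].

Lemma bump_values_ubound r A x : 0 <= r ->
  ubound [set Num.max 0 (r - mdist x a) | a in A] r.
Proof. by move=> r0 _ [a _ <-]; rewrite ge_max r0 gerBl mdist_ge0. Qed.

(** Asking [0 <= b] accounts for the truncation at [0] and for empty [A], leaving only untruncated
    values to bound. *)
Lemma bump_leP r A x (b : R) : 0 <= r -> 0 <= b ->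
  (forall a, A a -> r - mdist x a <= b) -> bump r A x <= b.
Proof.
move=> r0 b0 rb; rewrite /bump; have [->|/set0P[a Aa]] := eqVneq A set0.
  by rewrite image_set0 sup0.
apply: ge_sup; first by exists (Num.max 0 (r - mdist x a)); exists a.
by move=> _ [a' Aa' <-]; rewrite ge_max b0 rb.
Qed.

Lemma bump_ge r A x a : 0 <= r -> A a -> Num.max 0 (r - mdist x a) <= bump r A x.
Proof.
move=> r0 Aa; apply: ub_le_sup; last by exists a.
by exists r; exact: bump_values_ubound.
Qed.

Lemma bump_ge0 r A x : 0 <= r -> 0 <= bump r A x.
Proof.
move=> r0; have [->|/set0P[a Aa]] := eqVneq A set0.
  by rewrite /bump image_set0 sup0.
by apply: le_trans (bump_ge x r0 Aa); rewrite le_max lexx.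
Qed.

Lemma bump_le r A x : 0 <= r -> bump r A x <= r.
Proof. by move=> r0; apply: bump_leP => // a _; rewrite gerBl mdist_ge0. Qed.

Lemma bump_lipschitz r A x y : 0 <= r ->
  `|bump r A x - bump r A y| <= mdist x y.
Proof.
move=> r0; suff H z t : bump r A z <= bump r A t + mdist z t.
  rewrite ler_norml; have := H x y; have := H y x.
  by rewrite [mdist y x]metric_sym; lra.
apply: bump_leP => // [|a Aa]; first by rewrite addr_ge0 ?mdist_ge0 ?bump_ge0.
have := bump_ge t r0 Aa; rewrite ge_max => /andP[_].
have := metric_triangle t z a; rewrite [mdist t z]metric_sym; lra.
Qed.

Lemma bump_eq r A x : 0 <= r -> A x -> bump r A x = r.
Proof.
move=> r0 Ax; apply/eqP; rewrite eq_le bump_le//=.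
by have := bump_ge x r0 Ax; rewrite mdistxx subr0 ge_max => /andP[].
Qed.

Lemma bump_eq0 r A x : 0 <= r -> (forall a, A a -> r <= mdist x a) ->
  bump r A x = 0.
Proof.
move=> r0 rA; apply/eqP; rewrite eq_le bump_ge0// andbT.
by apply: bump_leP => // a /rA; rewrite subr_le0.
Qed.

(* Aharoni's construction at scale [r]: disjointify the balls of radius [2 r]
   around a dense sequence and take the bumps around the resulting cells. *)
Lemma separable_bumps (r : R) : 0 < r -> separable_space X ->
  exists g : nat -> X -> R,
    [/\ forall k x, 0 <= g k x <= r,
        forall k x y, `|g k x - g k y| <= mdist x y,
        forall x, exists N, forall k, (N <= k)%N -> g k x = 0 &
        forall x y, 5 * r <= mdist x y -> exists k, g k x = r /\ g k y = 0].
Proof.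
move=> r0 [D /countable_injP[e eI] dD]; have r0' := ltW r0.
have near_D x : exists2 a, D a & mdist x a < r.
  have [|a [xa Da]] := dD (ball x r)° _ (open_interior _).
    by exists x; exact: nbhsx_ballx.
  by exists a => //; have := interior_subset xa; rewrite ballEmdist.
pose A k : set X := [set y |
  (exists a, [/\ D a, e a = k & mdist a y < 2 * r]) /\
  (forall a, D a -> (e a < k)%N -> 2 * r <= mdist a y)].
exists (fun k => bump r (A k)); split.
- by move=> k x; rewrite bump_ge0// bump_le.
- by move=> k x y; exact: bump_lipschitz.
(* For [a] in [D] within [r] of [x], every point of a cell with index above [e a] is at least [2 r]
   from [a], hence at least [r] from [x]. *)
- move=> x; have [a Da xa] := near_D x; exists (e a).+1 => k ak.
  apply: bump_eq0 => // y [_ /(_ a Da ak) ay].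
  by have := metric_triangle a x y; rewrite [mdist a x]metric_sym; lra.
- move=> x y xy.
  (* The least [k] whose ball contains [x] gives the cell of [x]. Points [z] of this cell share the
     centre [a], so [mdist x z < 4 r], and the gap [5 r] leaves [mdist z y > r]. *)
  pose P k := `[< exists a, [/\ D a, e a = k & mdist a x < 2 * r] >].
  have exP : exists k, P k.
    have [a Da xa] := near_D x; exists (e a); apply/asboolP; exists a.
    by split => //; rewrite metric_sym; lra.
  have [k /asboolP Pk k_min] := ex_minnP exP.
  have Akx : A k x.
    split=> // a Da ak; rewrite leNgt; apply/negP => ax.
    have : P (e a) by apply/asboolP; exists a.
    by move=> /k_min; rewrite leqNgt ak.
  exists k; split; first exact: bump_eq.
  apply: bump_eq0 => // z [[b [Db bk bz]] _].
  case: Pk => a [Da ak ax].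
  have ab : a = b by apply: eI; rewrite ?inE// ak bk.
  move: bz; rewrite -ab => az.
  have := metric_triangle x y z; have := metric_triangle x a z.
  have := metric_triangle x a y; have := metric_triangle a z y.
  rewrite [mdist z y]metric_sym [mdist x a]metric_sym; lra.
Qed.

End bumps.

(** * From bumps to a sequence of real coordinates *)

Lemma lipschitz_continuous (R : realType) (X : metricType R) (g : X -> R) :
  (forall x y, `|g x - g y| <= mdist x y) -> continuous g.
Proof.
move=> g_lip x; apply/cvgrPdist_lt => e e0.
have : nbhs x (ball x e) by exact: nbhsx_ballx.
by rewrite ballEmdist; apply: filterS => y; exact: le_lt_trans.
Qed.

Lemma half_expn_lt (R : realType) (e : R) : 0 < e ->
  exists J, forall j, (J <= j)%N -> 2^-1 ^+ j < e.
Proof.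
move=> e0; have := @cvg_expr R (2^-1) _.
rewrite ger0_norm ?invr_ge0// invf_lt1 ?ltr1n// => /(_ isT).
move=> /cvgr0Pnorm_lt /(_ _ e0) [J _ HJ]; exists J => j Jj.
by have := HJ j Jj; rewrite ger0_norm// exprn_ge0.
Qed.

(* [m] runs through codes of triples [(n, (j, k))]; the coordinate with code [m]
   is the [k]-th bump at scale [2 ^- j] of the [n]-th entry.  For fixed [n] all
   but finitely many differences are small, so that convergence to [0] along [m]
   amounts to convergence to [0] of the suprema over [(j, k)] as [n] grows. *)
Lemma Eprod0_coordinates (R : realType) (M : nat -> metricType R) :
  (forall n, separable_space (M n)) ->
  exists G : nat -> prod_topology M -> R,
    [/\ forall m, continuous (G m),
        forall m x, 0 <= G m x <= 1 &
        forall x y, Eprod0 x y <-> (G m x - G m y @[m --> \oo] --> (0 : R))].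
Proof.
move=> sepM; pose r j : R := 2^-1 ^+ j.
have r0 j : 0 < r j by rewrite exprn_gt0.
have r1 j : r j <= 1 by rewrite exprn_ile1// invf_le1// ler1n.
pose bumps (nj : nat * nat) := cid (separable_bumps (r0 nj.2) (sepM nj.1)).
have [g gP] := all_tag bumps.
(* Indices that code no triple give the coordinate [0], so they never affect convergence. *)
pose G m (x : prod_topology M) : R :=
  if @pickle_inv (nat * (nat * nat))%type m is Some (n, (j, k))
  then g (n, j) k (x n) else 0.
have GE n j k x : G (pickle (n, (j, k))) x = g (n, j) k (x n).
  by rewrite /G pickleK_inv.
exists G; split.
- move=> m; rewrite /G; case: (pickle_inv m) => [[n [j k]]|]; last first.
    exact: cst_continuous.
  have [_ glip _ _] := gP (n, j).
  move=> x; apply: (@continuous_comp _ _ _ (fun x : prod_topology M => x n)).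
    exact: (@proj_continuous nat M n).
  exact: lipschitz_continuous (glip k) (x n).
- move=> m x; rewrite /G; case: (pickle_inv m) => [[n [j k]]|]; last first.
    by rewrite lexx ler01.
  have [/(_ k (x n))/andP[-> gr] _ _ _] := gP (n, j).
  exact: le_trans gr (r1 j).
move=> x y; split=> [xy|Gxy].
- apply/cvgr0Pnorm_lt => e e0.
  have /cvgr0Pnorm_lt/(_ _ e0)[N _ xyN] := xy.
  have [J rJ] := half_expn_lt e0.
  have /choice[K KP] (nj : nat * nat) : exists K, forall k, (K <= k)%N ->
      g nj k (x nj.1) = 0 /\ g nj k (y nj.1) = 0.
    have [_ _ gfin _] := gP nj.
    have [Kx Kxg] := gfin (x nj.1); have [Ky Kyg] := gfin (y nj.1).
    exists (maxn Kx Ky) => k; rewrite geq_max => /andP[? ?].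
    by rewrite Kxg// Kyg.
  (* [B] bounds the relevant [K], and [m0] the codes in the box [n < N], [j < J], [k < B]. Outside
     the box a difference is small by the Lipschitz bound, the range [[0, 2^-j]] or vanishing. *)
  pose B := (\max_(nj : 'I_N * 'I_J) K (nj.1 : nat, nj.2 : nat))%N.
  pose m0 := (\max_(t : 'I_N * ('I_J * 'I_B))
    pickle (t.1 : nat, (t.2.1 : nat, t.2.2 : nat)))%N.
  exists m0.+1 => // m /= m0m; rewrite /G.
  case Em: (pickle_inv m) => [[n [j k]]|]; last by rewrite subr0 normr0.
  have [g01 glip _ _] := gP (n, j).
  have [Nn|nN] := leqP N n.
    apply: le_lt_trans (glip k _ _) _.
    by have := xyN n Nn; rewrite ger0_norm// mdist_ge0.
  have [Jj|jJ] := leqP J j.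
    apply: le_lt_trans (rJ _ Jj); rewrite ler_norml.
    move: (g01 k (x n)) (g01 k (y n)) => /=; rewrite -/(r j).
    by move: (r j) => rj; lra.
  have KB : (K (n, j) <= B)%N.
    exact: (@leq_bigmax _ (fun nj : 'I_N * 'I_J => K (nj.1 : nat, nj.2 : nat))
      (Ordinal nN, Ordinal jJ)).
  have [Bk|kB] := leqP B k.
    by have [/= -> ->] := KP (n, j) k (leq_trans KB Bk); rewrite subr0 normr0.
  have : (pickle (n, (j, k)) <= m0)%N.
    exact: (@leq_bigmax _ (fun t : 'I_N * ('I_J * 'I_B) =>
      pickle (t.1 : nat, (t.2.1 : nat, t.2.2 : nat)))
      (Ordinal nN, (Ordinal jJ, Ordinal kB))).
  have -> : pickle (n, (j, k)) = m.
    by have := @pickle_invK (nat * (nat * nat))%type m; rewrite Em.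
  by rewrite leqNgt m0m.
- apply/cvgr0Pnorm_lt => e e0.
  (* With [5 * 2^-J < e], entries at distance at least [e] are separated at scale [J] by a bump
     whose two values differ by exactly [2^-J]. *)
  have [J /(_ J (leqnn J)) rJ] := half_expn_lt (divr_gt0 e0 (ltr0n R 5)).
  have /cvgr0Pnorm_lt/(_ _ (r0 J))[m0 _ Gm0] := Gxy.
  (* [N] exceeds every first component coded below [m0], so for [n >= N] the triples starting with
     [n] have codes at least [m0], where differences are below [2^-J]. *)
  pose N := (\max_(i < m0)
    if @pickle_inv (nat * (nat * nat))%type i is Some (n, _) then n.+1 else 0)%N.
  exists N => // n /= Nn; rewrite ger0_norm ?mdist_ge0// ltNge; apply/negP => exy.
  have [_ _ _ gsep] := gP (n, J).
  have [|k [gx gy]] := gsep (x n) (y n).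
    by rewrite (le_trans _ exy)// mulrC -ler_pdivlMr// ltW.
  have [m0m|mm0] := leqP m0 (pickle (n, (J, k))).
    by have := Gm0 _ m0m; rewrite !GE gx gy subr0 gtr0_norm// ltxx.
  suff : (n < N)%N by rewrite ltnNge Nn.
  rewrite /N; have /= := @leq_bigmax _ (fun i : 'I_m0 =>
    if @pickle_inv (nat * (nat * nat))%type i is Some (n, _) then n.+1 else 0%N)
    (Ordinal mm0).
  by rewrite pickleK_inv.
Qed.

(** * Rounding to dyadic grids *)

Section dyadic_rounding.
Context {R : realType}.

(** [Num.trunc] is the integer part only of nonnegative numbers, so this rounds down for [0 <= t],
    the range in use. *)
Definition dyadic_floor (n : nat) (t : R) : R :=
  (Num.trunc (2 ^+ n * t))%:R / 2 ^+ n.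

Lemma dyadic_floor_grid n t : 0 <= t <= 1 -> dyadic_grid n (dyadic_floor n t).
Proof.
move=> /andP[t0 t1]; exists (Num.trunc (2 ^+ n * t)) => //=.
have nt0 : 0 <= 2 ^+ n * t by rewrite mulr_ge0// exprn_ge0.
rewrite -(ler_nat R) natrX; apply: le_trans (ler_piMr _ t1); last by rewrite exprn_ge0.
by rewrite truncn_le.
Qed.

Lemma dyadic_floor_near n t : 0 <= t -> `|dyadic_floor n t - t| <= 2^-1 ^+ n.
Proof.
move=> t0; have p0 : 0 < (2 : R) ^+ n by rewrite exprn_gt0.
have /truncn_itv/andP[ft tf] : 0 <= 2 ^+ n * t by rewrite mulr_ge0// ltW.
rewrite exprVn -(ler_pM2l p0) divff ?gt_eqF// -[X in X * `|_|]gtr0_norm// -normrM.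
rewrite mulrBr /dyadic_floor mulrC divfK ?gt_eqF// ler_norml.
by move: ft tf; rewrite -natr1; lra.
Qed.

Lemma dyadic_floor_cvg (a b : nat -> R) :
  (forall n, 0 <= a n) -> (forall n, 0 <= b n) ->
  (a n - b n @[n --> \oo] --> (0 : R)) <->
  (dyadic_floor n (a n) - dyadic_floor n (b n) @[n --> \oo] --> (0 : R)).
Proof.
move=> a0 b0.
have err (c : nat -> R) : (forall n, 0 <= c n) ->
    dyadic_floor n (c n) - c n @[n --> \oo] --> (0 : R).
  move=> c0; apply/cvgr0Pnorm_lt => e e0.
  have [J HJ] := half_expn_lt e0; exists J => // n Jn.
  exact: le_lt_trans (dyadic_floor_near n (c0 n)) (HJ n Jn).
have dab : (dyadic_floor n (a n) - a n) - (dyadic_floor n (b n) - b n)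
    @[n --> \oo] --> (0 : R).
  by rewrite -[X in _ --> X]subr0; apply: cvgB; exact: err.
split=> ab.
- rewrite -[X in _ --> X]addr0 (_ : (fun n => _) = (fun n => (a n - b n) +
      ((dyadic_floor n (a n) - a n) - (dyadic_floor n (b n) - b n)))).
    exact: cvgD ab dab.
  by apply/funext => n; ring.
- rewrite -[X in _ --> X]subr0 (_ : (fun n => _) = (fun n =>
      (dyadic_floor n (a n) - dyadic_floor n (b n)) -
      ((dyadic_floor n (a n) - a n) - (dyadic_floor n (b n) - b n)))).
    exact: cvgB ab dab.
  by apply/funext => n; ring.
Qed.

End dyadic_rounding.

(** * The three reductions *)

(** Brings the targets of the last two reductions to the form given by the coordinates: the metric
    of [set_type] is the restricted [|y - x|]. *)
Lemma Eprod0_set_typeE (R : realType) (A : nat -> set R^o)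
    (u v : prod_topology (fun n => set_type (A n))) :
  Eprod0 u v <-> (set_val (u n) - set_val (v n) : R) @[n --> \oo] --> (0 : R).
Proof.
have E n : mdist (u n) (v n) = `|(set_val (u n) : R) - set_val (v n)|.
  by rewrite distrC.
rewrite /Eprod0; under eq_fun do rewrite E.
exact: norm_cvg0P.
Qed.

Theorem theorem3p4 (R : realType) (M : nat -> metricType R)
    (Mcomplete : forall n : nat, complete_space (M n))
    (Mseparable : forall n : nat, separable_space (M n)) :
  [/\ borel_reducible (@Eprod0 R M) (@Rmodc0 R),
      borel_reducible (@Eprod0 R M)
        (@Eprod0 R (fun _ : nat => set_type (@unit_interval R))) &
      borel_reducible (@Eprod0 R M)
        (@Eprod0 R (fun n : nat => set_type (@dyadic_grid R n)))].
Proof.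
have [G [Gc G01 GE]] := Eprod0_coordinates Mseparable.
have G0 m x : 0 <= G m x by have /andP[] := G01 m x.
split.
- exists (fun x m => G m x) => //; apply: continuous_borel_map.
  by apply: continuous_prod_topology => m; exact: Gc.
- have GI m x : G m x \in @unit_interval R by rewrite inE /unit_interval/= in_itv; exact: G01.
  exists (fun x m => SigSub (GI m x)).
    apply: continuous_borel_map; apply: continuous_prod_topology => m.
    by apply: continuous_comp_initial => x; exact: Gc.
  by move=> x y; rewrite Eprod0_set_typeE; exact: GE.
- have GI m x : dyadic_floor m (G m x) \in @dyadic_grid R m.
    by rewrite inE; exact: dyadic_floor_grid.
  exists (fun x m => SigSub (GI m x)); last first.
    move=> x y; rewrite Eprod0_set_typeE GE.
    by apply: (@dyadic_floor_cvg R (G ^~ x) (G ^~ y)).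
  (* On the grid [c] reads off the numerator, so it is injective. *)
  pose c n (u : set_type (@dyadic_grid R n)) : nat :=
    Num.trunc (2 ^+ n * (set_val u : R)).
  have cE n (k : nat) : Num.trunc (2 ^+ n * (k%:R / 2 ^+ n : R)) = k.
    by rewrite mulrC divfK ?natrK// expf_neq0.
  apply: (@borel_map_countable_coordinates _ _ c) => [n u v|n k].
    move=> uv; have [k _ ku] := set_valP u; have [l _ lv] := set_valP v.
    apply: val_inj; rewrite -[val u]ku -[val v]lv.
    suff -> : k = l by [].
    by rewrite -(cE n k) -(cE n l) ku lv.
  (* A fibre of the code is a half-open condition on [G n]: the difference of two closed sets. *)
  rewrite /c [X in borel_set X](_ : _ =
      [set x | k%:R <= 2 ^+ n * G n x] `&` ~` [set x | k.+1%:R <= 2 ^+ n * G n x]).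
    have cl (l : nat) : borel_set [set x | l%:R <= 2 ^+ n * G n x].
      rewrite -[X in borel_set X]setCK; apply: borel_setC; apply: borel_open.
      apply: closed_openC; apply: (@preimage_closed _ R^o
        (fun x => 2 ^+ n * G n x) [set t | l%:R <= t]); last exact: closed_ge.
      move=> x _; apply: (@continuous_comp _ _ _ (G n) ( *%R (2 ^+ n))).
        exact: Gc.
      exact: mulrl_continuous.
    by apply: borel_setI => //; exact: borel_setC.
  have p0 x : 0 <= 2 ^+ n * G n x by rewrite mulr_ge0// exprn_ge0.
  apply/seteqP; split => x /=; rewrite set_valE/= cE.
    by move=> /eqP; rewrite truncn_eq// ltNge => /andP[? /negP].
  by move=> [kG /negP Gk]; apply/eqP; rewrite truncn_eq// kG ltNge.
Qed.
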